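(* Let $k$ be a constant. Given a bounded and direction-preserving function $f:[n]\to\{-1,0,1\}$, the query complexity of computing a discrete Brouwer fixed point of $f$ (a point $i$ with $f(i)=0$) with at most $k$ rounds of queries is $\Theta(n^{1/k})$, for both deterministic and randomized algorithms.
   Context: $[n]=\{1,\dots,n\}$. $f$ is direction-preserving if $|f(i)-f(j)|\le 1$ whenever $|i-j|\le 1$, and bounded if $i+f(i)\in[n]$ for all $i\in[n]$. The algorithm has oracle access to $f$. In a $k$-round algorithm, each round's queries depend only on answers from earlier rounds (and random coins, if randomized); after round $k$ it outputs a solution. Deterministic query complexity: worst-case total number of queries to always succeed; randomized: worst-case expected number of queries of an algorithm succeeding with probability at least $2/3$ on every input. Asymptotics are as $n\to\infty$. *)

(* Defs.v *)
From HB Require Import structures.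
From mathcomp Require Import all_boot all_order all_algebra.
From mathcomp Require Import all_classical all_reals all_analysis.

Set Implicit Arguments.
Unset Strict Implicit.
Unset Printing Implicit Defensive.

Import Order.TTheory GRing.Theory Num.Theory.
Import numFieldNormedType.Exports.

Local Open Scope classical_set_scope.
Local Open Scope ring_scope.

(* The point p of [n] = {1, ..., n} is encoded by the i : 'I_n with p = i.+1. *)

Definition direction_preserving n (f : 'I_n -> int) : Prop :=
  forall i j : 'I_n, `|i%:Z - j%:Z| <= 1 -> `|f i - f j| <= 1.

Definition bounded_direction n (f : 'I_n -> int) : Prop :=
  forall i : 'I_n, 1 <= i.+1%:Z + f i <= n%:Z.

Definition brouwer_input n : set ('I_n -> int) :=
  [set f | [/\ forall i, f i \in [:: -1; 0; 1],
               direction_preserving f & bounded_direction f]].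

(* Deterministic algorithms using at most k rounds of oracle queries.  A round
   submits m queries simultaneously; the continuation may depend on their m
   answers (and, being nested, on those of all earlier rounds). *)
Inductive algorithm (n : nat) : nat -> Type :=
| Output k of 'I_n : algorithm n k
| Round k m of m.-tuple 'I_n & (m.-tuple int -> algorithm n k) :
    algorithm n k.+1.

Fixpoint output n k (A : algorithm n k) (f : 'I_n -> int) : 'I_n :=
  match A with
  | Output _ i => i
  | Round _ _ q next => output (next (map_tuple f q)) f
  end.

Fixpoint queries n k (A : algorithm n k) (f : 'I_n -> int) : nat :=
  match A with
  | Output _ _ => 0
  | Round _ m q next => (m + queries (next (map_tuple f q)) f)%N
  end.

Definition solves n k (A : algorithm n k) (f : 'I_n -> int) : Prop :=
  f (output A f) = 0.

(* All random coins are drawn beforehand from an arbitrary probability space;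
   the outcome selects a deterministic algorithm. *)
Record randomized_algorithm (R : realType) (n k : nat) := RandomizedAlgorithm {
  coin_display : measure_display;
  coins : measurableType coin_display;
  coin_law : probability coins R;
  strategy : coins -> algorithm n k;
  measurable_success : forall f, brouwer_input f ->
    measurable [set w | solves (strategy w) f];
  measurable_queries : forall f, brouwer_input f ->
    measurable_fun [set: coins] (fun w => (queries (strategy w) f)%:R : R)
}.
Arguments coin_law {R n k} _.
Arguments strategy {R n k} _ _.

Section query_complexity.
Context (R : realType) (k n : nat).
Local Open Scope ereal_scope.

Definition det_correct (A : algorithm n k) : Prop :=
  forall f, brouwer_input f -> solves A f.

Definition det_cost (A : algorithm n k) : \bar R :=
  ereal_sup [set (queries A f)%:R%:E | f in @brouwer_input n].

Definition det_query_complexity : \bar R :=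
  ereal_inf [set det_cost A | A in det_correct].

Definition rand_correct (A : randomized_algorithm R n k) : Prop :=
  forall f, brouwer_input f ->
    (2 / 3)%:E <= coin_law A [set w | solves (strategy A w) f].

Definition rand_cost (A : randomized_algorithm R n k) : \bar R :=
  ereal_sup [set 'E_(coin_law A)[fun w => (queries (strategy A w) f)%:R]
            | f in @brouwer_input n].

Definition rand_query_complexity : \bar R :=
  ereal_inf [set c | exists2 A, rand_correct A & c = rand_cost A].

End query_complexity.

(* Main.v *)
(* Upper bound: a bounded, direction-preserving [f] cannot jump over 0, so it
   vanishes somewhere in every interval on which it changes sign; with
   m > n^(1/k), each round splits the current interval into m blocks and keeps
   one at whose ends the signs differ, so k rounds isolate a zero.

   Lower bound: take the inputs sgn(z - i), one for each z.  On these, m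
   simultaneous queries have at most 2m + 1 possible answer vectors, so a
   deterministic algorithm solves at most (2b + 1)^k of the n inputs with at most
   b queries each.  Averaging over uniform z and over the coins, a randomized
   algorithm of cost Q satisfies 2n/3 <= (2b + 1)^k + n Q / (b + 1), and
   b ~ n^(1/k) / 12 gives Q >= (b + 1) / 3. *)
Require Import Defs.
From HB Require Import structures.
From mathcomp Require Import all_boot all_order all_algebra.
From mathcomp Require Import all_classical all_reals all_analysis.
From mathcomp Require Import measurable_realfun.
From mathcomp Require Import zify lra.

Set Implicit Arguments.
Unset Strict Implicit.
Unset Printing Implicit Defensive.

Import Order.TTheory GRing.Theory Num.Theory.
Import numFieldNormedType.Exports.

Local Open Scope classical_set_scope.
Local Open Scope ring_scope.

(** * Lower bound: hard inputs and counting *)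

Definition target_input n (z i : 'I_n) : int := Num.sg (z%:Z - i%:Z).

Lemma brouwer_target n (z : 'I_n) : brouwer_input (target_input z).
Proof.
have sg3 (x : int) : [/\ x < 0 & Num.sg x = -1] \/ [/\ x = 0 & Num.sg x = 0] \/
    [/\ 0 < x & Num.sg x = 1].
  by case: (sgrP x) => h; [right; left | right; right | left]; split.
split=> [i|i j|i].
- by rewrite /target_input; case: sgrP.
- rewrite /target_input.
  have := sg3 (z%:Z - i%:Z); have := sg3 (z%:Z - j%:Z); lia.
- rewrite /target_input; have := sg3 (z%:Z - i%:Z).
  have := ltn_ord z; have := ltn_ord i; lia.
Qed.

Lemma target_input_eq0 n (z i : 'I_n) : target_input z i = 0 -> i = z.
Proof. by move/eqP; rewrite sgr_eq0 subr_eq0 => /eqP[/val_inj]. Qed.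

Lemma target_input_le n (y z i : 'I_n) :
  (y <= z)%N -> target_input y i <= target_input z i.
Proof.
move=> yz; have h : y%:Z - i%:Z <= z%:Z - i%:Z by rewrite lerD2r lez_nat.
by rewrite /target_input; case: (sgrP (y%:Z - i%:Z)) h;
  case: (sgrP (z%:Z - i%:Z)) => //; lia.
Qed.

(* Since [target_input] is monotone in the target, the sum of the answers to a
   batch of queries determines each of them. *)
Definition answer_key n m (q : m.-tuple 'I_n) (z : 'I_n) : 'I_(m.*2.+1) :=
  inord `|\sum_(j < m) (target_input z (tnth q j) + 1)|.

Lemma answer_keyP n m (q : m.-tuple 'I_n) (y z : 'I_n) :
  answer_key q y = answer_key q z ->
  map_tuple (target_input y) q = map_tuple (target_input z) q.
Proof.
have bnd (x i : 'I_n) : 0 <= target_input x i + 1 <= 2.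
  by rewrite /target_input; case: sgrP.
have sum_ge0 x : 0 <= \sum_(j < m) (target_input x (tnth q j) + 1).
  by apply: sumr_ge0 => j _; case/andP: (bnd x (tnth q j)).
have sum_le x : \sum_(j < m) (target_input x (tnth q j) + 1) <= m.*2%:Z.
  apply: (@le_trans _ _ (\sum_(j < m) 2)).
    by apply: ler_sum => j _; case/andP: (bnd x (tnth q j)).
  by rewrite sumr_const card_ord; lia.
wlog yz : y z / (y <= z)%N.
  by move=> W; case/orP: (leq_total y z) => h e; [|apply/esym]; apply: W.
(* Each shifted answer lies in [0, 2], so the sum is at most 2m and [inord] is faithful on it. *)
move/(congr1 val); rewrite /= !inordK ?ltnS; last 2 first.
- by move: (sum_ge0 z) (sum_le z); lia.
- by move: (sum_ge0 y) (sum_le y); lia.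
move=> e.
(* The differences, each nonnegative since [y <= z], add up to 0, so each of them vanishes. *)
have {}e : \sum_(j < m) (target_input z (tnth q j) - target_input y (tnth q j)) = 0.
  rewrite -[RHS](subrr (\sum_(j < m) (target_input y (tnth q j) + 1))).
  have -> : \sum_(j < m) (target_input y (tnth q j) + 1) =
     \sum_(j < m) (target_input z (tnth q j) + 1) :> int.
    by move: (sum_ge0 y) (sum_ge0 z); lia.
  have {2}-> : \sum_(j < m) (target_input z (tnth q j) + 1) =
     \sum_(j < m) (target_input y (tnth q j) + 1) :> int.
    by move: (sum_ge0 y) (sum_ge0 z); lia.
  by rewrite -sumrB; apply: eq_bigr => j _; lia.
apply: eq_from_tnth => j; rewrite !tnth_map.
have h (i : 'I_m) :
    true -> 0 <= target_input z (tnth q i) - target_input y (tnth q i).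
  by move=> _; rewrite subr_ge0; apply: target_input_le.
move/eqP: e; rewrite (psumr_eq0 _ h) => /allP/(_ j (mem_index_enum _)) /=.
by rewrite subr_eq0 => /eqP.
Qed.

(** Induction on the rounds: targets with equal keys get equal answers, hence share the rest of the
    algorithm, and [m <= b] leaves at most 2b + 1 keys. A fixed output solves only one target. *)
Lemma card_cheap_targets n k (A : algorithm n k) b (D : {set 'I_n}) :
  (forall z, z \in D ->
     solves A (target_input z) /\ (queries A (target_input z) <= b)%N) ->
  (#|D| <= b.*2.+1 ^ k)%N.
Proof.
elim: A D => [{}k i|{}k m q next IH] D HD.
  apply: (@leq_trans 1); last by rewrite expn_gt0.
  apply/card_le1_eqP => y z /HD[/target_input_eq0 /= <- _].
  by move=> /HD[/target_input_eq0 /= <- _].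
have [->|[y yD]] := set_0Vmem D; first by rewrite cards0.
have mb : (m <= b)%N.
  by have [_ /=] := HD _ yD; apply: leq_trans; apply: leq_addr.
rewrite -sum1_card (partition_big (answer_key q) predT) //=.
apply: (@leq_trans (\sum_(c < m.*2.+1) b.*2.+1 ^ k)%N); last first.
  by rewrite sum_nat_const card_ord expnS leq_mul2r; lia.
apply: leq_sum => c _; rewrite sum1dep_card.
set Dc := finset _.
have [->|[z0]] := set_0Vmem Dc; first by rewrite cards0.
rewrite inE => /andP[z0D /eqP z0c].
apply: (IH (map_tuple (target_input z0) q)) => z.
rewrite inE => /andP[/HD[sz qz] /eqP zc].
have e : map_tuple (target_input z0) q = map_tuple (target_input z) q.
  by apply: answer_keyP; rewrite z0c zc.
move: sz qz; rewrite /solves /= -e => sz qz; split => //.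
by apply: leq_trans qz; apply: leq_addl.
Qed.

(** A solved target is either among the cheap ones or costs at least b + 1 queries. Being linear in
    both sums, the bound can be integrated over the coins. *)
Lemma card_solved_targets n k (A : algorithm n k) b :
  (b.+1 * \sum_z `[< solves A (target_input z) >] <=
   b.+1 * b.*2.+1 ^ k + \sum_z queries A (target_input z))%N.
Proof.
pose D := [set z | `[< solves A (target_input z) >] &
                   (queries A (target_input z) <= b)%N]%SET.
have := @card_cheap_targets _ _ A b D.
have /[swap]/[apply] : forall z, z \in D ->
     solves A (target_input z) /\ (queries A (target_input z) <= b)%N.
  by move=> z; rewrite inE => /andP[/asboolP].
rewrite -(leq_pmul2l (ltn0Sn b)) -(leq_add2r (\sum_z queries A (target_input z))%N).
apply: leq_trans.
rewrite -sum1dep_card [X in (_ <= _ * X + _)%N]big_mkcond !big_distrr -big_split.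
apply: leq_sum => z _.
case: asboolP => _; last exact: leq_trans (eq_leq (muln0 _)) _.
rewrite andTb [X in (X <= _)%N]muln1.
case: ifP => [_|/negbT]; first by rewrite [X in (_ <= X + _)%N]muln1 leq_addr.
by rewrite [X in (_ <= X + _)%N]muln0 -ltnNge.
Qed.

(** * Upper bound: block search *)

(* [f] continued by -1 beyond its domain, so that a bounded [f] always changes
   sign on [0, m] when [n < m]. *)
Definition extend n (f : 'I_n.+1 -> int) (x : nat) : int :=
  if (x < n.+1)%N then f (inord x) else -1.

(** Invariant: [extend f] changes sign on the interval of length [m.+1 ^ k] starting at [a].
    Admitting [ord0] always makes the arg max exist; the domain test discards probes that [inord]
    sends to a default point. *)
Fixpoint search n m k (a : nat) : algorithm n.+1 k :=
  match k with
  | 0 => Output _ (inord a)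
  | k.+1 => Round [tuple inord (a + j * m.+1 ^ k) | j < m.+1]
      (fun ans =>
        let j := [arg max_(j > ord0 | (j == ord0) ||
           (a + j * m.+1 ^ k < n.+1)%N && (0 <= tnth ans j)) val j] in
        search n m k (a + j * m.+1 ^ k))
  end.

Lemma queries_search n m k a f : queries (search n m k a) f = (k * m.+1)%N.
Proof. by elim: k a => [//|k IH] a /=; rewrite IH mulSn. Qed.

(** Inside the domain [f] changes by at most 1 per step; at the last point boundedness forces
    [f <= 0]. *)
Lemma extend_sign_change n (f : 'I_n.+1 -> int) a : brouwer_input f ->
  0 <= extend f a -> extend f a.+1 < 0 -> f (inord a) = 0.
Proof.
move=> [_ dir bnd]; rewrite /extend; case: (ltnP a n.+1) => // an fa.
case: (ltnP a.+1 n.+1) => [an'|na _].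
  have := dir (inord a) (inord a.+1); rewrite !inordK //; lia.
have := bnd (inord a); rewrite inordK //; lia.
Qed.

Lemma solves_search n m k a (f : 'I_n.+1 -> int) : brouwer_input f ->
  0 <= extend f a -> extend f (a + m.+1 ^ k) < 0 -> solves (search n m k a) f.
Proof.
move=> bf; elim: k a => [|k IH] a fa; rewrite /solves.
  by rewrite expn0 addn1; apply: extend_sign_change.
move=> fb /=; set P := fun j : 'I_m.+1 => _ || _.
have PE (j : 'I_m.+1) : P j = (0 <= extend f (a + j * m.+1 ^ k)).
  rewrite /P tnth_map tnth_mktuple /extend.
  have [->/=|_ /=] := eqVneq j ord0; last by case: ifP.
  by rewrite mul0n addn0 -/(extend f a) fa.
case: arg_maxnP; first by rewrite /P eqxx.
move=> j; rewrite PE => fj jmax; apply: IH => //.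
(* The next probe is negative by maximality of [j]; if there is none, the block ends where the
   interval does. *)
have [jm|mj] := ltnP j.+1 m.+1; last first.
  have -> : (a + j * m.+1 ^ k + m.+1 ^ k = a + m.+1 ^ k.+1)%N => //.
  by rewrite -addnA -mulSnr expnS; congr (_ + _ * _)%N; have := ltn_ord j; lia.
rewrite -addnA -mulSnr ltNge; apply/negP => fj1.
by have := jmax (Ordinal jm); rewrite PE => /(_ fj1) /=; rewrite ltnn.
Qed.

Lemma search_correct n m k : (n < m.+1 ^ k)%N -> det_correct (search n m k 0).
Proof.
move=> nm f bf; have [_ _ bnd] := bf; apply: solves_search => //.
  by rewrite /extend /=; have := bnd (inord 0); rewrite inordK //; lia.
by rewrite /extend add0n ltnNge nm.
Qed.

(** * Bounds for the two complexities *)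

Section complexity_bounds.
Context {R : realType}.
Local Open Scope ereal_scope.

Lemma rand_cost_ge n k b (A : randomized_algorithm R n k) :
  (0 < n)%N -> (3 * b.*2.+1 ^ k <= n)%N -> rand_correct A ->
  (b.+1%:R / 3)%:E <= rand_cost A.
Proof.
move=> n0 bn corr.
pose P := coin_law A.
pose S z := [set w | solves (strategy A w) (target_input z)].
pose X z w := (queries (strategy A w) (target_input z))%:R : R.
have mS z : measurable (S z) := measurable_success A (brouwer_target z).
have mX z : measurable_fun [set: coins A] (EFin \o X z).
  by apply/measurable_EFinP; apply: measurable_queries; apply: brouwer_target.
have X0 z w : 0 <= (X z w)%:E by rewrite lee_fin.
have m1 z : measurable_fun [set: coins A] (EFin \o (\1_(S z) : _ -> R)).
  by apply/measurable_EFinP; apply: measurable_indic.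
have mb z : measurable_fun [set: coins A]
    (fun w => (b.+1%:R)%:E * (\1_(S z) w)%:E : \bar R).
  by apply: measurable_funeM; exact: m1.
have ib0 z w : 0 <= (b.+1%:R)%:E * (\1_(S z) w)%:E :> \bar R.
  by rewrite mule_ge0 // lee_fin.
(* The counting bound is integrated over the coins, finite sums and integrals being exchanged. *)
have averaged : \sum_z ((b.+1%:R)%:E * P (S z)) <=
    (b.+1 * b.*2.+1 ^ k)%:R%:E + \sum_z 'E_P[X z].
  have -> : \sum_z ((b.+1%:R)%:E * P (S z)) =
      \int[P]_w \sum_z ((b.+1%:R)%:E * (\1_(S z) w)%:E).
    rewrite ge0_integral_sum //; apply: eq_bigr => z _.
    rewrite (ge0_integralZl P measurableT (m1 z)) ?lee_fin //; last first.
      by move=> w _; rewrite lee_fin.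
    by rewrite integral_indic // setIT.
  have -> : (b.+1 * b.*2.+1 ^ k)%:R%:E + \sum_z 'E_P[X z] =
      \int[P]_w ((b.+1 * b.*2.+1 ^ k)%:R%:E + \sum_z (X z w)%:E).
    rewrite ge0_integralD //; first last.
    - exact: emeasurable_sum.
    - by move=> w _; apply: sume_ge0.
    rewrite integral_cst // [X in _ * X](probability_setT P) mule1 ge0_integral_sum //.
    by congr (_ + _); apply: eq_bigr => z _; rewrite unlock.
  apply: ge0_le_integral => //.
  - by move=> w _; apply: sume_ge0.
  - exact: emeasurable_sum.
  - by apply: emeasurable_funD => //; exact: emeasurable_sum.
  move=> w _; have := card_solved_targets (strategy A w) b.
  rewrite -(ler_nat R) natrD natrM !natr_sum => h.
  rewrite !sumEFin -EFinD lee_fin -mulr_sumr; apply: le_trans h.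
  by rewrite ler_wpM2l.
have cost z : 'E_P[X z] <= rand_cost A.
  by apply: ereal_sup_ubound; exists (target_input z) => //; apply: brouwer_target.
have : \sum_(z < n) ((b.+1%:R)%:E * (2 / 3)%:E) <=
    (b.+1 * b.*2.+1 ^ k)%:R%:E + \sum_(z < n) rand_cost A.
  apply: (le_trans _ (le_trans averaged _)).
    apply: lee_sum => z _; rewrite lee_pmul2l //.
    by apply: corr; apply: brouwer_target.
  by apply: leeD2l; apply: lee_sum.
(* Cost +oo is trivial; -oo would bound a nonnegative expectation from above. *)
case: (rand_cost A) (cost (Ordinal n0)) => [r| |] c; last first.
- have : 0 <= 'E_P[X (Ordinal n0)] by apply: expectation_ge0 => w; rewrite -lee_fin.
  by move: c; rewrite leeNy_eq => /eqP ->.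
- by rewrite leey.
under eq_bigr do rewrite -EFinM.
have sum_n (y : R) : (\sum_(z < n) y = n%:R * y)%R.
  by rewrite sumr_const card_ord mulr_natl.
rewrite !sumEFin -EFinD lee_fin !sum_n => h.
have n0' : (0 < n%:R :> R)%R by rewrite ltr0n.
rewrite lee_fin -(ler_pM2l n0').
(* Cheap targets account for at most n/3 of the 2n/3 expected successes. *)
have : ((b.+1 * b.*2.+1 ^ k)%:R <= b.+1%:R * (n%:R / 3) :> R)%R.
  by rewrite natrM ler_wpM2l // ler_pdivlMr // -natrM ler_nat mulnC.
by move: h; nra.
Qed.

Lemma rand_complexity_le_det n k (A : algorithm n k) :
  det_correct A -> rand_query_complexity R k n <= det_cost R A.
Proof.
move=> cA.
have mS f : brouwer_input f -> measurable [set w : unit | solves ((fun=> A) w) f].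
  by [].
have mq f : brouwer_input f ->
    measurable_fun [set: unit] (fun w => (queries ((fun=> A) w) f)%:R : R).
  by move=> _; apply: measurable_cst.
(* The coin space is a single point. *)
pose B := RandomizedAlgorithm (\d_tt : probability unit R) mS mq.
have cB : rand_correct B.
  move=> f bf /=; rewrite (_ : [set _ | _] = setT).
    by rewrite probability_setT lee_fin; lra.
  by apply/seteqP; split=> // w _; apply: cA.
suff -> : det_cost R A = rand_cost B by apply: ereal_inf_lbound; exists B.
congr ereal_sup; apply/seteqP; split=> _ [f bf <-]; exists f => //;
  by rewrite -[X in 'E_ _[X]]/(cst _) expectation_cst.
Qed.

Lemma query_complexity_bounds n k m b :
  (n < m.+1 ^ k)%N -> (3 * b.*2.+1 ^ k <= n.+1)%N ->
  [/\ (b.+1%:R / 3)%:E <= rand_query_complexity R k n.+1,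
      rand_query_complexity R k n.+1 <= det_query_complexity R k n.+1 &
      det_query_complexity R k n.+1 <= (k * m.+1)%:R%:E].
Proof.
move=> nm bn; split.
- by apply: le_ereal_inf_tmp => _ [A cA ->]; apply: rand_cost_ge.
- by apply: le_ereal_inf_tmp => _ [A cA <-]; apply: rand_complexity_le_det.
apply: (@le_trans _ _ (det_cost R (search n m k 0))).
  by apply: ereal_inf_lbound; exists (search n m k 0) => //; apply: search_correct.
by apply: ge_ereal_sup => _ [f _ <-]; rewrite queries_search.
Qed.

End complexity_bounds.

(** * Asymptotics in n^(1/k) *)

Lemma query_complexity_sandwich (R : realType) k n : (0 < k)%N -> (6 ^ k <= n)%N ->
  [/\ 36^-1 * n%:R `^ k%:R^-1 <= fine (rand_query_complexity R k n),
      fine (rand_query_complexity R k n) <= fine (det_query_complexity R k n) &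
      fine (det_query_complexity R k n) <= (k%:R * 2) * n%:R `^ k%:R^-1].
Proof.
move=> k0 n6; case: n n6 => [|n] n6; first by move: n6; rewrite leqn0 expn_eq0.
set x := _ `^ _.
have xk : x ^+ k = n.+1%:R.
  rewrite -powR_mulrn ?powR_ge0 // -powRrM mulVf ?powRr1 //.
  by rewrite pnatr_eq0 -lt0n.
have x0 : 0 <= x := powR_ge0 _ _.
have x6 : 6 <= x.
  by rewrite -(ler_pXn2r k0) ?nnegrE // xk -natrX ler_nat.
pose m := Num.truncn x; pose b := Num.truncn (x / 12).
have mx : m%:R <= x by rewrite truncn_le.
have xm : x < m.+1%:R := truncnS_gt x.
have bx : b%:R <= x / 12 by rewrite truncn_le divr_ge0.
have xb : x / 12 < b.+1%:R := truncnS_gt _.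
have nm : (n < m.+1 ^ k)%N.
  by rewrite -(ler_nat R) -xk natrX lerXn2r ?nnegrE // ltW.
have bn : (3 * b.*2.+1 ^ k <= n.+1)%N.
  rewrite -(ler_nat R) natrM natrX -xk.
  (* Since x >= 6, 2b + 1 <= x/6 + 1 <= x/3; then 3 (x/3)^k <= x^k because k >= 1. *)
  have b3 : b.*2.+1%:R <= x / 3.
    by rewrite -natr1 -mul2n natrM; lra.
  apply: (@le_trans _ _ (3 * (x / 3) ^+ k)).
    by rewrite ler_wpM2l // lerXn2r // nnegrE ?divr_ge0.
  rewrite expr_div_n mulrCA ger_pMr ?exprn_gt0 //; last by lra.
  by rewrite ler_pdivrMr ?exprn_gt0 // mul1r ler_eXnr // ler1n.
have [lo mid hi] := query_complexity_bounds (R := R) nm bn.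
(* Finiteness matters because [fine] sends infinite values to 0. *)
have rfin : rand_query_complexity R k n.+1 \is a fin_num.
  by rewrite fin_numElt (lt_le_trans _ lo) ?ltNyr //
    (le_lt_trans (le_trans mid hi)) ?ltry.
have dfin : det_query_complexity R k n.+1 \is a fin_num.
  by rewrite fin_numElt (lt_le_trans _ (le_trans lo mid)) ?ltNyr //
    (le_lt_trans hi) ?ltry.
move: lo mid hi; rewrite -(fineK rfin) -(fineK dfin) !lee_fin => lo mid hi; split=> //.
(* b + 1 > x/12 gives the constant 1/36, and m + 1 <= 2x gives 2k. *)
- by apply: le_trans lo; lra.
- by apply: le_trans hi _; rewrite natrM -mulrA ler_wpM2l // -natr1; lra.
Qed.

Theorem theorem8 (R : realType) (k : nat) (hk : (0 < k)%N) :
  ((fun n : nat => fine (det_query_complexity R k n) : R)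
     \is 'Theta_\oo(fun n : nat => n%:R `^ (k%:R^-1) : R)) /\
  ((fun n : nat => fine (rand_query_complexity R k n) : R)
     \is 'Theta_\oo(fun n : nat => n%:R `^ (k%:R^-1) : R)).
Proof.
have pos : (0 < 36^-1 :> R) && (0 < k%:R * 2 :> R).
  by rewrite invr_gt0 mulr_gt0 ?ltr0n.
split; apply/asboolP; exists (36^-1, k%:R * 2) => //;
  apply: filterS (nbhs_infty_ge (6 ^ k)) => n;
  move=> /(query_complexity_sandwich R hk)[lo mid hi];
  have x0 : 0 <= n%:R `^ k%:R^-1 :> R := powR_ge0 _ _;
  rewrite (ger0_norm x0) ger0_norm.
- by split=> //; apply: le_trans mid.
- by apply: le_trans mid; apply: le_trans lo; rewrite mulr_ge0.
- by split=> //; apply: le_trans hi.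
- by apply: le_trans lo; rewrite mulr_ge0.
Qed.
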